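(* Let $\mu>0$, let $\theta:\mathcal X^n\to\mathbb R^p$ be a multivariate statistic whose sensitivity space $\mathcal S_\theta$ is rank-deficient, and let $\sigma>0$. The rank-deficient Gaussian mechanism $M_r(S)=\theta(S)+N_p(0,\sigma^2P_\theta)$ is $\mu$-GDP if and only if $\sigma\ge \Delta_2(\theta;\mathcal X^n)/\mu$.
   Context: $\mathcal X$ is a sample space and $n\ge1$. Data sets $S,S'\in\mathcal X^n$ are neighbors, written $S\sim S'$, if they differ in exactly one record (exactly one coordinate). The $L_2$-sensitivity of $\theta$ is $\Delta_2(\theta;\mathcal X^n)=\sup_{S\sim S'}\|\theta(S)-\theta(S')\|_2$. The sensitivity space of $\theta$ is $\mathcal S_\theta=\{\theta(S)-\theta(S'):S,S'\in\mathcal X^n,\ S\sim S'\}\subset\mathbb R^p$; it is called rank-deficient if $d_\theta:=\dim(\mathrm{span}(\mathcal S_\theta))<p$. $P_\theta$ denotes the $p\times p$ matrix of orthogonal projection onto $\mathrm{span}(\mathcal S_\theta)$. The notation $\theta(S)+N_p(0,\Sigma)$ means $\theta(S)+\xi$ with $\xi\sim N_p(0,\Sigma)$ (possibly singular covariance). For distributions $P,Q$ on a common space, the trade-off function is $T(P,Q)(\alpha)=\inf\{1-\mathbb E_Q\phi:\ \phi \text{ a } [0,1]\text{-valued measurable test},\ \mathbb E_P\phi\le\alpha\}$, $\alpha\in[0,1]$; for random elements, $T(X,Y)$ is the trade-off function of their laws. $G_\mu=T(N(0,1),N(\mu,1))$, i.e. $G_\mu(\alpha)=\Phi(\Phi^{-1}(1-\alpha)-\mu)$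 with $\Phi$ the standard normal distribution function. A mechanism $M$ (assigning to each fixed $S\in\mathcal X^n$ a random element $M(S)$) is $\mu$-GDP if $\inf_{S\sim S'}T(M(S),M(S'))\ge G_\mu$ pointwise on $[0,1]$. *)

(* Defs.v *)
From HB Require Import structures.
From mathcomp Require Import all_boot all_order all_algebra.
From mathcomp Require Import all_classical all_reals all_analysis.
From mathcomp Require Import measurable_realfun.

Set Implicit Arguments.
Unset Strict Implicit.
Unset Printing Implicit Defensive.

Import Order.TTheory GRing.Theory Num.Theory.
Import numFieldNormedType.Exports.

Local Open Scope classical_set_scope.
Local Open Scope ring_scope.

Section measurable_colvector.
Context {R : realType} (p : nat).

Let coord (i : 'I_p) (x : 'cV[R]_p) : R := x i 0.

Let cV_set0 : g_sigma_preimage coord set0.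
Proof. exact: sigma_algebra0. Qed.

Let cV_setC A : g_sigma_preimage coord A -> g_sigma_preimage coord (~` A).
Proof. exact: sigma_algebraC. Qed.

Let cV_bigcup (F : (set 'cV[R]_p)^nat) :
  (forall i, g_sigma_preimage coord (F i)) ->
  g_sigma_preimage coord (\bigcup_i (F i)).
Proof. exact: sigma_algebra_bigcup. Qed.

(* The sigma-algebra generated by the coordinates: the Borel sets of R^p. *)
HB.instance Definition _ := @isMeasurable.Build
  (measure_tuple_display default_measure_display) 'cV[R]_p
  (g_sigma_preimage coord) cV_set0 cV_setC cV_bigcup.

Lemma measurable_fun_cVP d (T : measurableType d) (f : T -> 'cV[R]_p) :
  (forall i, measurable_fun setT (fun t => f t i 0)) -> measurable_fun setT f.
Proof.
move=> mf.
suff sub : g_sigma_preimage (fun i => coord i \o f) `<=` measurable.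
  move: sub; rewrite g_sigma_preimage_comp => sub _ A mA.
  by apply: sub; exists A.
apply: smallest_sub; first exact: sigma_algebra_measurable.
apply: (big_ind (fun S : set (set T) => S `<=` measurable)) => //.
- by move=> A B sA sB; rewrite subUset.
- by move=> i _ A [B mB <-]; exact: mf.
Qed.

End measurable_colvector.

Definition l2norm (R : realType) (p : nat) (x : 'cV[R]_p) : R :=
  Num.sqrt (\sum_i x i 0 ^+ 2).

(* The library only spans finite sequences; the span of an arbitrary set is
   the least subspace containing it (see span_set_least). *)
Definition span_set (K : fieldType) (V : vectType K) (A : set V)
    : {vspace V} :=
  xget fullv [set U : {vspace V} | (forall x, A x -> x \in U) /\
    (forall W : {vspace V}, (forall x, A x -> x \in W) -> (U <= W)%VS)].

Lemma span_set_least (K : fieldType) (V : vectType K) (A : set V) :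
  (forall x, A x -> x \in span_set A) /\
  (forall W : {vspace V}, (forall x, A x -> x \in W) -> (span_set A <= W)%VS).
Proof.
suff [U HU] : exists U : {vspace V}, (forall x, A x -> x \in U) /\
    (forall W : {vspace V}, (forall x, A x -> x \in W) -> (U <= W)%VS).
  exact: (@xgetPex _ fullv [set U | _] (ex_intro _ U HU)).
pose Q k := `[< exists2 s : seq V, (forall x, x \in s -> A x) &
                  \dim << s >>%VS = k >].
have exQ : exists k, Q k.
  by exists (\dim << [::] : seq V >>%VS); apply/asboolP; exists [::].
have Qle k : Q k -> (k <= \dim (fullv : {vspace V}))%N.
  by move=> /asboolP[s _ <-]; exact: dimvS (subvf _).
have [k /asboolP[s sA dk] kmax] := ex_maxnP exQ Qle.
exists << s >>%VS; split; last first.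
  by move=> W AW; apply/span_subvP => x /sA; exact: AW.
move=> x Ax.
have sub : (<< s >> <= << x :: s >>)%VS.
  by apply: sub_span => y; rewrite inE orbC => ->.
have /kmax le : Q (\dim << x :: s >>%VS).
  apply/asboolP; exists (x :: s) => // y.
  by rewrite inE => /orP[/eqP->//|/sA].
have /eqP -> : << s >>%VS == << x :: s >>%VS by rewrite eqEdim sub dk.
by apply: memv_span; rewrite mem_head.
Qed.

(* P *m x is the orthogonal projection of x onto U, for every x. *)
Definition is_orth_proj (R : realType) (p : nat) (U : {vspace 'cV[R]_p})
    (P : 'M[R]_p) : Prop :=
  forall x : 'cV[R]_p, P *m x \in U /\
    forall u : 'cV[R]_p, u \in U -> u^T *m (x - P *m x) = 0.

Definition orth_proj (R : realType) (p : nat) (U : {vspace 'cV[R]_p})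
    : 'M[R]_p := xget 0 (is_orth_proj U).

Lemma orth_projP (R : realType) (p : nat) (U : {vspace 'cV[R]_p}) :
  is_orth_proj U (orth_proj U).
Proof.
suff [P HP] : exists P, is_orth_proj U P by exact: (xgetPex 0 (ex_intro _ P HP)).
pose k := \dim U.
pose B : 'M[R]_(p, k) := \matrix_(i, j) (vbasis U)`_j i 0.
have BE (c : 'cV[R]_k) : B *m c = \sum_(j < k) c j 0 *: (vbasis U)`_j.
  apply/matrixP => i j; rewrite ord1 mxE summxE.
  by apply: eq_bigr => l _; rewrite !mxE mulrC.
have BU c : B *m c \in U.
  rewrite BE; apply: memv_suml => j _; apply: memvZ.
  by apply: vbasis_mem; rewrite mem_nth// size_tuple.
have UB u : u \in U -> exists c, u = B *m c.
  move=> uU; pose c : 'cV[R]_k := \col_j coord (vbasis U) j u.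
  exists c; rewrite BE {1}(coord_vbasis uU).
  by apply: eq_bigr => j _; rewrite mxE.
have sq0 m (y : 'cV[R]_m) : y^T *m y = 0 -> y = 0.
  move=> /matrixP/(_ 0 0); rewrite !mxE => /eqP.
  rewrite psumr_eq0; last by move=> i _; rewrite mxE -expr2 sqr_ge0.
  move=> /allP y0; apply/matrixP => i j; rewrite ord1 mxE.
  have := y0 i; rewrite mem_index_enum => /(_ isT).
  by rewrite mxE -expr2 sqrf_eq0 => /eqP.
have Binj (c : 'cV[R]_k) : B *m c = 0 -> c = 0.
  have /freeP fr := basis_free (vbasisP U).
  rewrite BE => /fr c0.
  by apply/matrixP => i j; rewrite ord1 mxE; exact: c0.
have Gu : (B^T *m B) \in unitmx.
  rewrite -row_free_unit -kermx_eq0; apply/eqP/row_matrixP => i.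
  rewrite row0; set v := row i _.
  have vG : v *m (B^T *m B) = 0 by rewrite -row_mul mulmx_ker row0.
  apply: trmx_inj; rewrite trmx0; apply: Binj; apply: sq0.
  by rewrite trmx_mul trmxK mulmxA -(mulmxA v) vG mul0mx.
exists (B *m invmx (B^T *m B) *m B^T) => x; split.
  by rewrite -!mulmxA; exact: BU.
move=> u /UB[c ->]; rewrite trmx_mul -(mulmxA c^T) mulmxBr.
suff -> : B^T *m (B *m invmx (B^T *m B) *m B^T *m x) = B^T *m x.
  by rewrite subrr mulmx0.
by rewrite !mulmxA mulmxV// mul1mx.
Qed.

Section gaussian.
Context (R : realType).

Let cons_pair k (x : measurableTypeR R * k.-tuple R) : k.+1.-tuple R :=
  [the k.+1.-tuple R of x.1 :: x.2].

Let measurable_cons_pair k : measurable_fun setT (@cons_pair k).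
Proof.
apply: measurable_cons; last exact: measurable_snd.
exact: (@measurable_fst _ _ (measurableTypeR R) (k.-tuple R)).
Qed.

HB.instance Definition _ k :=
  isMeasurableFun.Build _ _ _ _ (@cons_pair k) (@measurable_cons_pair k).

(* Law of k independent N(0,1) variables: the k-fold product of N(0,1). *)
Fixpoint std_normal (k : nat) : probability (k.-tuple R) R :=
  match k with
  | 0 => \d_ [tuple]
  | k.+1 => distribution (normal_prob 0 1 \x std_normal k)%E
              [the {mfun _ >-> _} of @cons_pair k]
  end.

(* nu is N_p(m, Sigma): the law of m + A Z, where A A^T = Sigma and Z has
   independent N(0,1) coordinates; Sigma may be singular. Laws are compared on
   measurable sets only, since measures are total functions on sets. *)
Definition is_normal (p : nat) (m : 'cV[R]_p) (Sigma : 'M[R]_p)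
    (nu : probability 'cV[R]_p R) : Prop :=
  exists (k : nat) (A : 'M[R]_(p, k)), A *m A^T = Sigma /\
    forall B : set 'cV[R]_p, measurable B ->
      nu B = std_normal k [set z | B (m + A *m \col_i tnth z i)].

Lemma is_normal_exists (p k : nat) (m : 'cV[R]_p) (A : 'M[R]_(p, k)) :
  exists nu, is_normal m (A *m A^T) nu.
Proof.
pose f (z : k.-tuple R) : 'cV[R]_p := m + A *m \col_i tnth z i.
have mf : measurable_fun setT f.
  apply: measurable_fun_cVP => i.
  rewrite (_ : (fun t => _) =
    (fun t : k.-tuple R => m i 0 + \sum_j A i j * tnth t j)); last first.
    by apply/funext => t; rewrite !mxE; under eq_bigr do rewrite mxE.
  apply: measurable_funD; first exact: measurable_cst.
  apply: measurable_sum => j; apply: measurable_funM.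
    exact: measurable_cst.
  exact: measurable_tnth.
pose mfM := isMeasurableFun.Build _ _ _ _ f mf.
pose F : {mfun k.-tuple R >-> 'cV[R]_p} := HB.pack f mfM.
by exists (distribution (std_normal k) F), k, A.
Qed.

End gaussian.

Section privacy.
Context {R : realType}.
Local Open Scope ereal_scope.

Definition is_test d (T : measurableType d) (phi : T -> R) : Prop :=
  measurable_fun setT phi /\ forall x, (0 <= phi x <= 1)%R.

Definition tradeoff d (T : measurableType d) (P Q : probability T R) (a : R)
    : \bar R :=
  ereal_inf [set 1 - 'E_Q[phi] | phi in
    [set phi : T -> R | is_test phi /\ 'E_P[phi] <= a%:E]].

Definition gauss_tradeoff (mu : R) : R -> \bar R :=
  tradeoff (normal_prob 0 1) (normal_prob mu 1).

Definition neighbors (X : Type) (n : nat) (S S' : n.-tuple X) : Prop :=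
  exists i : 'I_n, tnth S i <> tnth S' i /\
    forall j : 'I_n, j != i -> tnth S j = tnth S' j.

Definition is_gdp (X : Type) (n : nat) d (Omega : measurableType d)
    (Pr : probability Omega R) d' (Y : measurableType d') (mu : R)
    (M : n.-tuple X -> {RV Pr >-> Y}) : Prop :=
  forall a : R, (0 <= a <= 1)%R ->
    gauss_tradeoff mu a <=
    ereal_inf [set tradeoff (distribution Pr (M S.1))
                            (distribution Pr (M S.2)) a
              | S in [set S : n.-tuple X * n.-tuple X | neighbors S.1 S.2]].

Definition sensitivity_space (X : Type) (n p : nat)
    (theta : n.-tuple X -> 'cV[R]_p) : set 'cV[R]_p :=
  [set (theta S.1 - theta S.2)%R
  | S in [set S : n.-tuple X * n.-tuple X | neighbors S.1 S.2]].

(* Possibly +oo; equal to -oo (rather than 0) when there are no neighbors. *)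
Definition l2_sensitivity (X : Type) (n p : nat)
    (theta : n.-tuple X -> 'cV[R]_p) : \bar R :=
  ereal_sup [set (l2norm (theta S.1 - theta S.2))%:E
            | S in [set S : n.-tuple X * n.-tuple X | neighbors S.1 S.2]].

Definition rank_deficient (X : Type) (n p : nat)
    (theta : n.-tuple X -> 'cV[R]_p) : Prop :=
  (\dim (span_set (sensitivity_space theta)) < p)%N.

Definition is_rank_deficient_gaussian (X : Type) (n p : nat)
    (theta : n.-tuple X -> 'cV[R]_p) (sigma : R) d (Omega : measurableType d)
    (Pr : probability Omega R) (M : n.-tuple X -> {RV Pr >-> 'cV[R]_p})
    : Prop :=
  forall S, exists2 xi : {RV Pr >-> 'cV[R]_p},
    is_normal 0
      (sigma ^+ 2 *: orth_proj (span_set (sensitivity_space theta)))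
      (distribution Pr xi)
    & forall w, M S w = (theta S + xi w)%R.

End privacy.

(* Main.v *)
Require Import Defs.
From HB Require Import structures.
From mathcomp Require Import all_boot all_order all_algebra.
From mathcomp Require Import all_classical all_reals all_analysis.
From mathcomp Require Import measurable_realfun ring lra.

Import Order.TTheory GRing.Theory Num.Theory.
Import numFieldNormedType.Exports.

Local Open Scope classical_set_scope.
Local Open Scope ring_scope.

Set Implicit Arguments.
Unset Strict Implicit.

(** Let v = theta(S') - theta(S) for neighbors S and S', and let P be the
projection onto the span of the sensitivity space, so that P v = v.  A Gaussian
law depends only on its covariance A A^T: a product of two standard normal laws
is invariant under plane rotations (compositions of three shears), and Givens
rotations of the columns of A reduce it row by row to a canonical form.  When
w in the span has norm at most sigma, sigma^2 P = w w^T + D D^T for an explicit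
D, so the mechanism can be written theta(S) + t w + D Z with t standard normal
and independent of Z.

If |v| <= mu sigma, take w = v / mu: passing from S to S' shifts t by mu, hence
a test between M(S) and M(S') yields, after averaging over Z, a test between
N(0,1) and N(mu,1) with the same errors.  Conversely, if m = |v| / sigma
exceeds mu, take w = v / m, which is orthogonal to the columns of D: a
half-space test orthogonal to w only sees t, and its errors are those of the
threshold test between N(0,1) and N(m,1).  With threshold mu / 2 for t it beats the
Neyman-Pearson optimal test between N(0,1) and N(mu,1) at the same level. *)

(** * Normal laws on the line *)

Section normal_integral.
Context {R : realType}.
Local Notation leb := (@lebesgue_measure R).
Local Open Scope ereal_scope.

Import HBNNSimple.

(** On indicators this is the definition of [normal_prob] by its density; linearity gives simple
    functions, monotone convergence the rest. *)
Lemma ge0_integral_normal_prob (m s : R) (f : R -> \bar R) :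
  measurable_fun setT f -> (forall x, 0 <= f x) ->
  \int[normal_prob m s]_x f x = \int[leb]_x (f x * (normal_pdf m s x)%:E).
Proof.
have pdf0 x : 0 <= (normal_pdf m s x)%:E by rewrite lee_fin normal_pdf_ge0.
have mpdf : measurable_fun setT (fun x => (normal_pdf m s x)%:E).
  by apply/measurable_EFinP; exact: measurable_normal_pdf.
have intI (E : set R) : measurable E ->
    \int[normal_prob m s]_x (\1_E x)%:E =
    \int[leb]_x ((\1_E x)%:E * (normal_pdf m s x)%:E).
  move=> mE; rewrite integral_indic//= setIT /normal_prob.
  rewrite integral_mkcond; apply: eq_integral => x _.
  by rewrite patchE indicE; case: (x \in E); rewrite ?mul1e ?mul0e.
move=> mf f0.
have intS (g : {nnsfun R >-> R}) :
    \int[normal_prob m s]_x (g x)%:E =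
    \int[leb]_x ((g x)%:E * (normal_pdf m s x)%:E).
  have mI r : measurable_fun setT (fun x : R => (r * \1_(g @^-1` [set r]) x)%:E).
    by apply/measurable_EFinP; apply: measurableT_comp.
  under [LHS]eq_integral do rewrite fimfunE -fsumEFin//.
  rewrite [LHS]ge0_integral_fsum//; last first.
    by move=> n x _; rewrite EFinM nnfun_muleindic_ge0.
  under [RHS]eq_integral.
    move=> x xD; rewrite fimfunE -fsumEFin// muleC ge0_mule_fsumr; last first.
      by move=> r; rewrite EFinM nnfun_muleindic_ge0.
    over.
  rewrite [RHS]ge0_integral_fsum//; last 2 first.
  - by move=> r; apply: emeasurable_funM => //; exact: mI.
  - by move=> n x _; rewrite mule_ge0// EFinM nnfun_muleindic_ge0.
  apply: eq_fsbigr => r _.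
  (* A negative [r] has an empty level set, so only nonnegative scalars have to be pulled out of the
     integrals. *)
  have [r0|r0] := leP 0%R r; last first.
    rewrite (_ : g @^-1` [set r] = set0).
      by rewrite !integral0_eq// => x _; rewrite indicE in_set0 mulr0 ?mule0.
    apply/seteqP; split => // x /= gx.
    by have : (0 <= g x)%R; [exact: fun_ge0|rewrite gx leNgt r0].
  have mE : measurable (g @^-1` [set r]) by [].
  have mE1 : measurable_fun setT (fun x => (\1_(g @^-1` [set r]) x)%:E : \bar R).
    by apply/measurable_EFinP; exact: measurable_indic.
  under eq_integral do rewrite EFinM.
  under [RHS]eq_integral => x _ do rewrite EFinM muleCA (muleC (normal_pdf m s x)%:E).
  rewrite !ge0_integralZl//= ?intI//.
  - exact: emeasurable_funM.
  - by move=> x _; apply: mule_ge0; rewrite ?lee_fin ?normal_pdf_ge0.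
pose f_ := nnsfun_approx measurableT mf.
have ndf x a b : (a <= b)%N -> (f_ a x <= f_ b x)%R.
  by move=> ab; have /lefP := nd_nnsfun_approx measurableT mf ab; apply.
transitivity (lim (\int[normal_prob m s]_x (f_ n x)%:E @[n --> \oo])).
  rewrite -monotone_convergence//=.
  - apply: eq_integral => ? /[!inE] xD; apply/esym/cvg_lim => //=.
    exact: cvg_nnsfun_approx.
  - by move=> n; apply/measurable_EFinP; exact: (measurable_funPT (f_ n)).
  - by move=> n ? _; rewrite lee_fin.
  - by move=> x _ a b ab; rewrite lee_fin; exact: ndf.
rewrite [RHS](_ : _ = lim
    (\int[leb]_x ((f_ n x)%:E * (normal_pdf m s x)%:E) @[n --> \oo])); last first.
  rewrite -monotone_convergence//=.
  - apply: eq_integral => x _; apply/esym/cvg_lim => //.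
    apply: cvgeZr => //. exact: cvg_nnsfun_approx.
  - move=> n; apply: emeasurable_funM => //.
    by apply/measurable_EFinP; exact: (measurable_funPT (f_ n)).
  - by move=> n ? _; rewrite mule_ge0// lee_fin.
  - by move=> x _ a b ab; rewrite lee_wpmul2r// lee_fin; exact: ndf.
by apply: congr_lim; apply/funext => n /=; exact: intS.
Qed.

(** Lebesgue measure is determined by its values on half-open intervals, whose lengths a translation
    preserves. *)
Lemma lebesgue_measure_shift (a : R) (A : set R) : measurable A ->
  leb [set x | A (x + a)%R] = leb A.
Proof.
move=> mA.
have mshift : measurable_fun setT (fun x : R => x + a)%R.
  exact: measurable_funD.
pose mixin := isMeasurableFun.Build _ _ _ _
  (fun x : R => (x + a)%R : measurableTypeR R) mshift.
pose sh : {mfun R >-> measurableTypeR R} := HB.pack (fun x : R => (x + a)%R) mixin.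
rewrite [RHS](@lebesgue_measure_unique R (pushforward leb sh))//.
move=> _ [[u v] /= _ <-]; rewrite /pushforward.
rewrite (_ : _ @^-1` _ = `]u - a, v - a]%classic%R); last first.
  by apply/seteqP; split => x /=; rewrite !in_itv/= ltrBlDr lerBrDr.
rewrite !lebesgue_measure_itv/= !lte_fin ltrD2r.
by case: ifP => // _; rewrite -!EFinD; congr EFin; ring.
Qed.

Lemma ge0_integral_lebesgue_shift (a : R) (f : R -> \bar R) :
  measurable_fun setT f -> (forall x, 0 <= f x) ->
  \int[leb]_x f (x + a)%R = \int[leb]_x f x.
Proof.
move=> mf f0.
have mshift : measurable_fun setT
    (fun x : measurableTypeR R => (x + a)%R : measurableTypeR R).
  exact: measurable_funD.
rewrite -(ge0_integral_pushforward mshift leb measurableT)//.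
apply: eq_measure_integral => A mA _; exact: lebesgue_measure_shift.
Qed.

End normal_integral.

(** * Rotation invariance *)

Section rotation.
Context {R : realType}.
Local Notation leb := (@lebesgue_measure R).
Local Notation N01 := (normal_prob (0 : R) 1).
Local Notation RR := (measurableTypeR R * measurableTypeR R)%type.
Local Open Scope ereal_scope.

Lemma measurable_lincomb2 (a b c d : R) :
  measurable_fun setT
    (fun z : RR => ((a * z.1 + b * z.2)%R, (c * z.1 + d * z.2)%R) : RR).
Proof.
have m1 : measurable_fun setT (fst : RR -> R) by exact: measurable_fst.
have m2 : measurable_fun setT (snd : RR -> R) by exact: measurable_snd.
by apply: measurable_fun_pair; apply: measurable_funD; exact: measurable_funM.
Qed.

Implicit Types F : RR -> \bar R.

Lemma ge0_integral_shear2 (t : R) F :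
  measurable_fun setT F -> (forall z, 0 <= F z) ->
  \int[leb]_x \int[leb]_y F (x, y + t * x)%R = \int[leb]_x \int[leb]_y F (x, y).
Proof.
move=> mF F0; apply: eq_integral => x _.
apply: (@ge0_integral_lebesgue_shift _ _ (fun y => F (x, y))) => //.
exact: measurableT_comp.
Qed.

(** Tonelli makes the sheared variable the inner one, where the shear is a translation. *)
Lemma ge0_integral_shear1 (t : R) F :
  measurable_fun setT F -> (forall z, 0 <= F z) ->
  \int[leb]_x \int[leb]_y F (x + t * y, y)%R = \int[leb]_x \int[leb]_y F (x, y).
Proof.
move=> mF F0.
pose G (z : RR) := F (z.1 + t * z.2, z.2)%R.
have mG : measurable_fun setT G.
  apply: measurableT_comp => //.
  have := measurable_lincomb2 1 t 0 1.
  by under eq_fun do rewrite !mul1r mul0r add0r.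
have G0 z : 0 <= G z by exact: F0.
transitivity (\int[leb]_y \int[leb]_x G (x, y)).
  exact: (fubini_tonelli G mG G0).
transitivity (\int[leb]_y \int[leb]_x F (x, y)); last first.
  by apply/esym; exact: (fubini_tonelli F mF F0).
apply: eq_integral => y _; rewrite /G/=.
apply: (@ge0_integral_lebesgue_shift _ _ (fun x => F (x, y))) => //.
exact: measurableT_comp.
Qed.

Lemma ge0_integral_lebesgue_rotation (c s : R) F :
  (c ^+ 2 + s ^+ 2 = 1)%R -> s != 0%R ->
  measurable_fun setT F -> (forall z, 0 <= F z) ->
  \int[leb]_x \int[leb]_y F (c * x - s * y, s * x + c * y)%R =
  \int[leb]_x \int[leb]_y F (x, y).
Proof.
move=> cs s0 mF F0.
(* For the rotation of angle [u] with sine [s], this is [- tan (u / 2)]: shearing the first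
   coordinate by [t], the second by [s] and the first again by [t] gives the rotation. *)
pose t := ((c - 1) / s)%R.
pose F1 (z : RR) := F (z.1 + t * z.2, z.2)%R.
pose F2 (z : RR) := F1 (z.1, z.2 + s * z.1)%R.
have mF1 : measurable_fun setT F1.
  apply: measurableT_comp => //.
  have := measurable_lincomb2 1 t 0 1.
  by under eq_fun do rewrite !mul1r mul0r add0r.
have mF2 : measurable_fun setT F2.
  apply: measurableT_comp => //.
  have := measurable_lincomb2 1 0 s 1.
  by under eq_fun do rewrite !mul1r mul0r addr0 addrC.
rewrite -(ge0_integral_shear1 t mF F0).
rewrite -(ge0_integral_shear2 s mF1 (fun z => F0 _)).
rewrite -(ge0_integral_shear1 t mF2 (fun z => F0 _)).
apply: eq_integral => x _; apply: eq_integral => y _.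
rewrite /F2 /F1/=; congr (F (_, _)).
  have -> : (x + t * y + t * (y + s * (x + t * y)) =
             (1 + t * s) * x + t * (1 + (1 + t * s)) * y)%R by ring.
  have -> : (t * s = c - 1)%R by rewrite /t divfK.
  have -> : (t * (1 + (1 + (c - 1))) = - s)%R.
    apply: (mulIf s0); transitivity (c ^+ 2 + s ^+ 2 - 1 - s ^+ 2)%R.
      by rewrite /t; field.
    by rewrite cs; ring.
  ring.
have -> : (y + s * (x + t * y) = s * x + (1 + t * s) * y)%R by ring.
by rewrite /t divfK// (addrC 1%R) subrK.
Qed.

Lemma measurable_normal_fubini F : measurable_fun setT F -> (forall z, 0 <= F z) ->
  measurable_fun setT (fun x => \int[N01]_y F (x, y)).
Proof. by move=> mF F0; exact: (measurable_fun_fubini_tonelli_F F). Qed.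

Lemma ge0_integral_normal2 F : measurable_fun setT F -> (forall z, 0 <= F z) ->
  \int[N01]_x \int[N01]_y F (x, y) =
  \int[leb]_x \int[leb]_y (F (x, y) * (normal_pdf 0 1 x * normal_pdf 0 1 y)%:E).
Proof.
move=> mF F0.
have pdf0 x : 0 <= (normal_pdf (0 : R) 1 x)%:E by rewrite lee_fin normal_pdf_ge0.
have mpdf : measurable_fun setT (fun x => (normal_pdf (0 : R) 1 x)%:E).
  by apply/measurable_EFinP; exact: measurable_normal_pdf.
rewrite ge0_integral_normal_prob//; last 2 first.
- exact: measurable_normal_fubini.
- by move=> x; exact: integral_ge0.
apply: eq_integral => x _.
have mFx : measurable_fun setT (fun y => F (x, y)) by exact: measurableT_comp.
rewrite ge0_integral_normal_prob// -ge0_integralZr//; last 2 first.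
- exact: emeasurable_funM.
- by move=> y _; exact: mule_ge0.
by apply: eq_integral => y _; rewrite EFinM -muleA (muleC (normal_pdf 0 1 y)%:E).
Qed.

Lemma normal_pdf_rotation (c s x y : R) : (c ^+ 2 + s ^+ 2 = 1)%R ->
  (normal_pdf 0 1 (c * x - s * y) * normal_pdf 0 1 (s * x + c * y) =
   normal_pdf 0 1 x * normal_pdf 0 1 y)%R.
Proof.
move=> cs; rewrite !normal_pdfE// /normal_fun !subr0.
rewrite [LHS]mulrACA [RHS]mulrACA -!expRD; congr (_ * expR _)%R.
rewrite -!mulrDl; congr (_ / _)%R.
have -> : (- (c * x - s * y) ^+ 2 - (s * x + c * y) ^+ 2 =
  - ((c ^+ 2 + s ^+ 2) * (x ^+ 2 + y ^+ 2)))%R by ring.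
by rewrite cs; ring.
Qed.

(** The product density depends only on [x ^+ 2 + y ^+ 2], so for nonzero [s] the Lebesgue rotation
    is applied to [F] times this density. *)
Lemma ge0_integral_normal_rotation (c s : R) F : (c ^+ 2 + s ^+ 2 = 1)%R ->
  measurable_fun setT F -> (forall z, 0 <= F z) ->
  \int[N01]_x \int[N01]_y F (c * x - s * y, s * x + c * y)%R =
  \int[N01]_x \int[N01]_y F (x, y).
Proof.
move=> cs mF F0.
have mrot c' s' (G : RR -> \bar R) : measurable_fun setT G ->
    measurable_fun setT
      (fun z : RR => G (c' * z.1 - s' * z.2, s' * z.1 + c' * z.2)%R).
  move=> mG; apply: measurableT_comp => //.
  have := measurable_lincomb2 c' (- s') s' c'.
  by under eq_fun do rewrite mulNr.
have base c' s' (G : RR -> \bar R) : (c' ^+ 2 + s' ^+ 2 = 1)%R -> s' != 0%R ->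
    measurable_fun setT G -> (forall z, 0 <= G z) ->
    \int[N01]_x \int[N01]_y G (c' * x - s' * y, s' * x + c' * y)%R =
    \int[N01]_x \int[N01]_y G (x, y).
  move=> cs' s0 mG G0.
  apply: (etrans (ge0_integral_normal2 (mrot c' s' G mG) (fun z => G0 _))).
  apply: (etrans _ (esym (ge0_integral_normal2 mG G0))).
  pose H (z : RR) := G z * (normal_pdf 0 1 z.1 * normal_pdf 0 1 z.2)%:E.
  have mH : measurable_fun setT H.
    apply: emeasurable_funM => //; apply/measurable_EFinP.
    have mpdf : measurable_fun setT (normal_pdf (0 : R) 1 : measurableTypeR R -> R).
      exact: measurable_normal_pdf.
    apply: measurable_funM.
      exact: (measurableT_comp mpdf measurable_fst).
    exact: (measurableT_comp mpdf measurable_snd).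
  have H0 z : 0 <= H z.
    by rewrite mule_ge0// lee_fin mulr_ge0// normal_pdf_ge0.
  apply: (etrans _ (ge0_integral_lebesgue_rotation cs' s0 mH H0)).
  apply: eq_integral => x _; apply: eq_integral => y _.
  by rewrite /H/= normal_pdf_rotation.
have [s0|] := eqVneq s 0%R; last by move=> ?; exact: base.
(* A half turn is twice a quarter turn. *)
have : (c == 1%R) || (c == (-1)%R) by rewrite -sqrf_eq1 -cs s0 expr0n addr0.
case/orP => /eqP ->; rewrite s0.
  apply: eq_integral => x _; apply: eq_integral => y _.
  by rewrite !mul1r !mul0r subr0 add0r.
have q : (0 ^+ 2 + 1 ^+ 2 = 1 :> R)%R by rewrite expr0n expr1n add0r.
apply: etrans (base _ _ _ q (oner_neq0 _) mF F0).
apply: etrans (base _ _ _ q (oner_neq0 _) (mrot 0%R 1%R F mF) (fun z => F0 _)).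
apply: eq_integral => x _; apply: eq_integral => y _ /=.
by congr (F (_, _)); ring.
Qed.

End rotation.

(** * Gaussian means along a list of columns *)

Section gauss_mean.
Context {R : realType} {p : nat}.
Local Notation N01 := (normal_prob (0 : R) 1).
Local Notation RR := (measurableTypeR R * measurableTypeR R)%type.
Local Open Scope ereal_scope.

Implicit Types (g : 'cV[R]_p -> \bar R) (m a b : 'cV[R]_p) (s : seq 'cV[R]_p).

(* E g(m + A Z), where Z is standard normal and the list holds the columns of A. *)
Fixpoint gauss_mean g s m : \bar R :=
  if s is a :: s' then \int[N01]_x gauss_mean g s' (m + x *: a)%R else g m.

Lemma gauss_mean_ge0 g s m : (forall y, 0 <= g y) -> 0 <= gauss_mean g s m.
Proof. by move=> g0; elim: s m => [|a s IH] m //=; exact: integral_ge0. Qed.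

Lemma measurable_coord (i : 'I_p) :
  measurable_fun setT (fun y : 'cV[R]_p => y i 0%R).
Proof.
move=> _ B mB; apply: sub_sigma_algebra.
rewrite (bigD1 i)//=; left; exists B => //.
Qed.

Lemma measurable_shift_line d (T : measurableType d) (f : T -> 'cV[R]_p)
    (h : T -> R) a :
  measurable_fun setT f -> measurable_fun setT h ->
  measurable_fun setT (fun t => f t + h t *: a)%R.
Proof.
move=> mf mh; apply: measurable_fun_cVP => i.
under eq_fun do rewrite !mxE.
apply: measurable_funD; last exact: measurable_funM.
exact: (measurableT_comp (measurable_coord i) mf).
Qed.

Lemma measurable_gauss_mean g s : measurable_fun setT g -> (forall y, 0 <= g y) ->
  measurable_fun setT (gauss_mean g s).
Proof.
move=> mg g0; elim: s => [//|a s IH] /=.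
pose h (z : 'cV[R]_p * measurableTypeR R) := gauss_mean g s (z.1 + z.2 *: a)%R.
apply: (measurable_fun_fubini_tonelli_F (m2 := N01) h) => //.
  apply: measurableT_comp => //.
  by apply: measurable_shift_line; [exact: measurable_fst|exact: measurable_snd].
by move=> z; exact: gauss_mean_ge0.
Qed.

(** Regrouping, [x *: (c *: a + d *: b) + y *: (c *: b - d *: a)] has coefficients [c * x - d * y]
    on [a] and [d * x + c * y] on [b], a rotation of [(x, y)]. *)
Lemma gauss_mean_rotation g s m a b (c d : R) : (c ^+ 2 + d ^+ 2 = 1)%R ->
  measurable_fun setT g -> (forall y, 0 <= g y) ->
  gauss_mean g [:: c *: a + d *: b, c *: b - d *: a & s]%R m =
  gauss_mean g [:: a, b & s] m.
Proof.
move=> cd mg g0 /=.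
pose F (z : RR) := gauss_mean g s (m + z.1 *: a + z.2 *: b)%R.
have mF : measurable_fun setT F.
  apply: measurableT_comp; first exact: measurable_gauss_mean.
  apply: measurable_shift_line; last exact: measurable_snd.
  by apply: measurable_shift_line => //; exact: measurable_fst.
have F0 z : 0 <= F z by exact: gauss_mean_ge0.
apply: etrans (ge0_integral_normal_rotation cd mF F0).
apply: eq_integral => x _; apply: eq_integral => y _.
rewrite /F/=; congr (gauss_mean g s _).
by apply/matrixP => i j; rewrite !mxE; ring.
Qed.

(** Discards the columns that [g] does not see: each integrates a constant against a law of mass
    1. *)
Lemma gauss_mean_invariant g s m :
  (forall a, a \in s -> forall y (x : R), g (y + x *: a)%R = g y) ->
  (forall y, 0 <= g y) -> gauss_mean g s m = g m.
Proof.
move=> + g0; elim: s m => [//|a s IH] m inv /=.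
under eq_integral => x _.
  rewrite IH; last by move=> b bs; apply: inv; rewrite inE bs orbT.
  rewrite inv ?mem_head//; over.
by rewrite integral_cst//= probability_setT mule1.
Qed.

Lemma le_gauss_mean g g' s m : measurable_fun setT g -> measurable_fun setT g' ->
  (forall y, 0 <= g y) -> (forall y, g y <= g' y) ->
  gauss_mean g s m <= gauss_mean g' s m.
Proof.
move=> mg mg' g0 gg'; elim: s m => [//|a s IH] m /=.
have g'0 y : 0 <= g' y by exact: le_trans (gg' y).
have mJ h : measurable_fun setT h -> (forall y, 0 <= h y) ->
    measurable_fun setT
      (fun x : measurableTypeR R => gauss_mean h s (m + x *: a)%R).
  move=> mh h0; apply: measurableT_comp; first exact: measurable_gauss_mean.
  by apply: measurable_shift_line.
apply: ge0_le_integral => //; try exact: mJ.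
by move=> x _; exact: gauss_mean_ge0.
Qed.

End gauss_mean.

(** * Gram matrices and Givens reduction of column lists *)

Section gram.
Context {R : realType} {p : nat}.
Implicit Types (g : 'cV[R]_p -> \bar R) (m a b : 'cV[R]_p) (s : seq 'cV[R]_p).

(** This is [A *m A^T] for the matrix [A] whose columns are listed in [s], written as a sum of outer
    products so that it follows the recursion on lists. *)
Definition gram s : 'M[R]_p := \sum_(a <- s) a *m a^T.

Lemma gramE s i j : gram s i j = \sum_(a <- s) a i 0 * a j 0.
Proof. by rewrite summxE; apply: eq_bigr => a _; rewrite !mxE big_ord1 !mxE. Qed.

Lemma gram_cons a s : gram (a :: s) = a *m a^T + gram s.
Proof. by rewrite /gram big_cons. Qed.

Lemma gram_cons_rotation (c d : R) a b s : c ^+ 2 + d ^+ 2 = 1 ->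
  gram [:: c *: a + d *: b, c *: b - d *: a & s] = gram [:: a, b & s].
Proof.
move=> cd; rewrite !gram_cons !addrA; congr (_ + _).
apply/matrixP => i j; rewrite !mxE !big_ord1 !mxE.
rewrite -[RHS]mul1r -cd; ring.
Qed.

(** Givens rotations, applied from the tail of the list towards its head, gather row [i] into the
    leading column and clear it in all the others. *)
Lemma gauss_mean_row_reduce s (i : 'I_p) : exists a s',
  [/\ 0 <= a i 0, forall b, b \in s' -> b i 0 = 0, gram (a :: s') = gram s &
   forall g m, measurable_fun setT g -> (forall y, 0 <= g y)%E ->
     gauss_mean g (a :: s') m = gauss_mean g s m].
Proof.
elim: s => [|b s [a [s' [a0 s'0 eqG eqJ]]]].
  (* A zero column serves as leading column for the empty list. *)
  exists 0, [::]; split=> //; first by rewrite mxE.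
    by rewrite gram_cons mul0mx add0r.
  move=> g m mg g0 /=.
  under eq_integral do rewrite scaler0 addr0.
  by rewrite integral_cst//= probability_setT mule1.
(* The rotation sends the pair of entries [(b i 0, a i 0)] to [(r, 0)], where [r] is its Euclidean
   norm; if [r] is zero the identity rotation will do. *)
have [c [d [cd ge0 eq0]]] : exists c d : R, [/\ c ^+ 2 + d ^+ 2 = 1,
    0 <= c * b i 0 + d * a i 0 & c * a i 0 - d * b i 0 = 0].
  have [r0|r0] := eqVneq (b i 0 ^+ 2 + a i 0 ^+ 2) 0.
    exists 1, 0; move/eqP: r0; rewrite paddr_eq0 ?sqr_ge0// !sqrf_eq0.
    by case/andP=> /eqP -> /eqP ->; rewrite expr1n expr0n !mul0r !mulr0 !addr0 subr0.
  pose r := Num.sqrt (b i 0 ^+ 2 + a i 0 ^+ 2).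
  have r2 : r ^+ 2 = b i 0 ^+ 2 + a i 0 ^+ 2.
    by rewrite sqr_sqrtr// addr_ge0 ?sqr_ge0.
  have rN0 : r != 0 by rewrite -sqrf_eq0 r2.
  exists (b i 0 / r), (a i 0 / r); split.
  - by rewrite !expr_div_n -mulrDl -r2 divff// sqrf_eq0.
  - rewrite -!mulrA !(mulrCA _ r^-1) -mulrDr mulr_ge0 ?invr_ge0 ?sqrtr_ge0//.
    by rewrite -!expr2 addr_ge0 ?sqr_ge0.
  - by ring.
exists (c *: b + d *: a), (c *: a - d *: b :: s'); split.
- by rewrite !mxE.
- by move=> e; rewrite inE => /predU1P[->|/s'0//]; rewrite !mxE.
- by rewrite gram_cons_rotation// gram_cons eqG [RHS]gram_cons.
- move=> g m mg g0; rewrite gauss_mean_rotation//=.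
  by apply: eq_integral => x _; rewrite -eqJ.
Qed.

(* Cholesky factorisations with nonnegative pivots are unique: once both lists
   are reduced at the same row, their leading columns coincide. *)
Lemma eq_gauss_mean g s t m : measurable_fun setT g -> (forall y, 0 <= g y)%E ->
  gram s = gram t -> gauss_mean g s m = gauss_mean g t m.
Proof.
move=> mg g0 st.
have col0 (u : seq 'cV[R]_p) (i : 'I_p) : gram u i i = 0 ->
    forall a, a \in u -> a i 0 = 0.
  move=> /eqP; rewrite gramE psumr_eq0; last by move=> a _; rewrite -expr2 sqr_ge0.
  by move=> /allP h a /h; rewrite -expr2 sqrf_eq0 => /eqP.
(* Induction on the number [q] of rows that may be nonzero: a zero diagonal entry of the Gram matrix
   forces the whole row to vanish in every column. *)
suff : forall q, (q <= p)%N -> forall s t m, gram s = gram t ->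
    (forall i : 'I_p, (q <= i)%N -> gram s i i = 0) ->
    gauss_mean g s m = gauss_mean g t m.
  by move=> /(_ p (leqnn p) s t m st); apply => i; rewrite leqNgt ltn_ord.
move=> {s t m st} q; elim: q => [_|q IH qp] s t m st s0.
  have inv u : (forall i : 'I_p, gram u i i = 0) -> gauss_mean g u m = g m.
    move=> u0; apply: gauss_mean_invariant => // a au y x.
    rewrite (_ : a = 0) ?scaler0 ?addr0//.
    by apply/matrixP => i j; rewrite ord1 mxE (col0 _ _ (u0 i)).
  by rewrite !inv// => i; rewrite -?st s0.
pose i := Ordinal qp.
have [a [s' [a0 s'0 sE sJ]]] := gauss_mean_row_reduce s i.
have [b [t' [b0 t'0 tE tJ]]] := gauss_mean_row_reduce t i.
have gramrow (c : 'cV[R]_p) u j : (forall b, b \in u -> b i 0 = 0) ->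
    gram (c :: u) i j = c i 0 * c j 0.
  move=> u0; rewrite gram_cons !mxE big_ord1 !mxE gramE big1_seq ?addr0//.
  by move=> e /andP[_ /u0 ->]; rewrite mul0r.
have row_eq j : a i 0 * a j 0 = b i 0 * b j 0.
  by rewrite -(gramrow a s')// -(gramrow b t')// sE tE st.
have aibi : a i 0 = b i 0.
  by apply/eqP; rewrite -(eqrXn2 (n := 2))// !expr2 row_eq.
rewrite -sJ// -tJ//.
(* With a zero pivot, row [i] already vanishes and the induction applies to the full lists;
   otherwise row [i] of the Gram matrix determines the leading column, which is peeled off. *)
have [ai0|aiN0] := eqVneq (a i 0) 0.
  apply: IH; [exact: ltnW|by rewrite sE tE|move=> j].
  rewrite leq_eqVlt => /predU1P[/esym ji|/s0]; last by rewrite sE.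
  by rewrite (_ : j = i); [rewrite gramrow// ai0 mul0r|exact: val_inj].
have ab : a = b.
  by apply/matrixP => j k; rewrite ord1; apply: (mulfI aiN0); rewrite row_eq aibi.
rewrite -ab in tE *; apply: eq_integral => x _; apply: IH; first exact: ltnW.
  by apply: (addrI (a *m a^T)); rewrite -!gram_cons sE tE.
move=> j; rewrite leq_eqVlt => /predU1P[/esym ji|/s0].
  rewrite (_ : j = i); last exact: val_inj.
  by rewrite gramE big1_seq// => e /andP[_ /s'0 ->]; rewrite mul0r.
(* The diagonal entry is a sum of two nonnegative terms, so rows that vanish before peeling still
   vanish after it. *)
rewrite -sE gram_cons !mxE big_ord1 !mxE -expr2 => /eqP.
rewrite paddr_eq0 ?sqr_ge0//; last first.
  by rewrite gramE sumr_ge0// => e _; rewrite -expr2 sqr_ge0.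
by case/andP => _ /eqP.
Qed.

End gram.

(** * Normal laws as iterated one-dimensional integrals *)

Section normal_law.
Context {R : realType}.
Local Notation N01 := (normal_prob (0 : R) 1).
Local Open Scope ereal_scope.

Lemma ge0_integral_std_normalS k (f : k.+1.-tuple R -> \bar R) :
  measurable_fun setT f -> (forall z, 0 <= f z) ->
  \int[std_normal R k.+1]_z f z =
  \int[N01]_x \int[std_normal R k]_z f [the k.+1.-tuple R of x :: z].
Proof.
move=> mf f0 /=.
apply: (etrans (ge0_integral_distribution _ mf f0)) => /=.
apply: (etrans (fubini_tonelli1 _ _ _)) => //=.
apply: measurableT_comp => //.
by apply: measurable_cons; [exact: measurable_fst|exact: measurable_snd].
Qed.

Lemma measurable_tuple_lincomb p k (s : seq 'cV[R]_p) m : measurable_fun setT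
  (fun z : k.-tuple R => (m + \sum_(i < k) tnth z i *: s`_i)%R).
Proof.
apply: measurable_fun_cVP => i.
under eq_fun do rewrite mxE summxE.
apply: measurable_funD => //; apply: measurable_sum => j.
under eq_fun do rewrite mxE.
by apply: measurable_funM => //; exact: measurable_tnth.
Qed.

Lemma integral_std_normalE p (g : 'cV[R]_p -> \bar R) (s : seq 'cV[R]_p) k m :
  measurable_fun setT g -> (forall y, 0 <= g y) -> size s = k ->
  \int[std_normal R k]_z g (m + \sum_(i < k) tnth z i *: s`_i)%R =
  gauss_mean g s m.
Proof.
move=> mg g0 <-.
have mlin m' (u : seq 'cV[R]_p) : measurable_fun setT
    (fun z : (size u).-tuple R => g (m' + \sum_(i < size u) tnth z i *: u`_i)%R).
  by apply: measurableT_comp => //; exact: measurable_tuple_lincomb.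
elim: s m => [|a s IH] m.
  rewrite /= integral_dirac//; last exact: (mlin m [::]).
  by rewrite diracT mul1e big_ord0 addr0.
rewrite (ge0_integral_std_normalS (mlin m (a :: s)))//=.
apply: eq_integral => x _; rewrite -IH.
apply: eq_integral => z _; congr g.
rewrite big_ord_recl/= -addrA; congr (_ + (_ + _))%R.
by apply: eq_bigr => i _; rewrite tnthS.
Qed.

(** The factor [A] hidden in [is_normal] is arbitrary; since Gaussian means depend only on the Gram
    matrix, its columns can be exchanged for any convenient list [s]. *)
Lemma integral_is_normal p (m : 'cV[R]_p) (Sigma : 'M[R]_p)
    (nu : probability 'cV[R]_p R) (s : seq 'cV[R]_p) (g : 'cV[R]_p -> \bar R) :
  is_normal m Sigma nu -> gram s = Sigma ->
  measurable_fun setT g -> (forall y, 0 <= g y) ->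
  \int[nu]_y g y = gauss_mean g s m.
Proof.
move=> [k [A [<- nuE]]] gS mg g0.
pose t := [seq col i A | i <- enum 'I_k].
have st : size t = k by rewrite size_map size_enum_ord.
have gt : gram t = (A *m A^T)%R.
  apply/matrixP => i j; rewrite gramE big_map big_enum/= !mxE.
  by apply: eq_bigr => l _; rewrite !mxE.
rewrite (eq_gauss_mean m mg g0 (etrans gS (esym gt))).
rewrite -(integral_std_normalE m mg g0 st).
have mf := measurable_tuple_lincomb (k := k) t m.
apply: (etrans _ (ge0_integral_pushforward mf (std_normal R k) measurableT mg
  (fun y _ => g0 y))).
apply: eq_measure_integral => B mB _; apply: (etrans (nuE B mB)).
congr (std_normal R k _).
apply/seteqP; split => z /=; congr B; congr (_ + _)%R.
all: apply/matrixP => i j; rewrite ord1 mxE summxE; apply: eq_bigr => l _.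
all: by rewrite !mxE (nth_map l) ?size_enum_ord// nth_ord_enum mxE mulrC.
Qed.

End normal_law.

(** * Splitting off a direction of the covariance *)

Section projection.
Context {R : realType} {p : nat}.
Implicit Types (v w : 'cV[R]_p) (U : {vspace 'cV[R]_p}).

Lemma mxdotE v w : (v^T *m w) 0 0 = \sum_i v i 0 * w i 0.
Proof. by rewrite mxE; apply: eq_bigr => i _; rewrite mxE. Qed.

Lemma mxdot_l2norm v : v^T *m v = (l2norm v ^+ 2)%:M.
Proof.
apply/matrixP => i j; rewrite !ord1 mxdotE mxE eqxx mulr1n sqr_sqrtr.
  by apply: eq_bigr => k _; rewrite expr2.
by apply: sumr_ge0 => k _; rewrite sqr_ge0.
Qed.

Lemma l2normZ (c : R) v : 0 <= c -> l2norm (c *: v) = c * l2norm v.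
Proof.
move=> c0; rewrite /l2norm -[c in RHS]ger0_norm// -sqrtr_sqr -sqrtrM ?sqr_ge0//.
by congr Num.sqrt; rewrite mulr_sumr; apply: eq_bigr => i _; rewrite mxE exprMn.
Qed.

Lemma l2norm_ge0 v : 0 <= l2norm v. Proof. exact: sqrtr_ge0. Qed.

Lemma l2norm0_eq0 v : l2norm v = 0 -> v = 0.
Proof.
move=> v0; have := mxdotE v v; rewrite mxdot_l2norm v0 mxE eqxx expr0n/=.
move=> /esym/eqP; rewrite psumr_eq0 => [|i _]; last by rewrite -expr2 sqr_ge0.
move=> /allP h; apply/matrixP => i j; rewrite ord1 mxE.
have := h i; rewrite mem_index_enum => /(_ isT).
by rewrite -expr2 sqrf_eq0 => /eqP.
Qed.

(** The residual lies in [U] and is orthogonal to [U], hence to itself. *)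
Lemma orth_proj_id U v : v \in U -> orth_proj U *m v = v.
Proof.
move=> vU; have [PU Portho] := orth_projP U v.
have vPU : v - orth_proj U *m v \in U by exact: memvB.
have := Portho _ vPU; rewrite mxdot_l2norm => /matrixP/(_ 0 0)/eqP.
rewrite !mxE eqxx mulr1n sqrf_eq0 => /eqP/l2norm0_eq0/eqP.
by rewrite subr_eq0 => /eqP <-.
Qed.

Lemma orth_proj_idem U : orth_proj U *m orth_proj U = orth_proj U.
Proof.
apply/matrixP => i j.
have := orth_proj_id (orth_projP U (delta_mx j 0)).1.
by rewrite mulmxA -!colE => /matrixP/(_ i 0); rewrite !mxE.
Qed.

Lemma orth_proj_sym U : (orth_proj U)^T = orth_proj U.
Proof.
set Q := orth_proj U.
(* The right-hand side is symmetric; the identity says that the residuals of basis vectors are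
   orthogonal to the columns of [Q]. *)
suff h : Q^T = Q^T *m Q by rewrite -[in RHS](trmxK Q) h trmx_mul trmxK.
apply/matrixP => i j.
have := (orth_projP U (delta_mx j 0)).2 _ (orth_projP U (delta_mx i 0)).1.
rewrite -/Q trmx_mul trmx_delta mulmxBr => /eqP; rewrite subr_eq0 => /eqP.
move=> /matrixP/(_ 0 0); rewrite -!mulmxA.
by rewrite -!rowE -!colE !mxE => ->; apply: eq_bigr => k _; rewrite !mxE.
Qed.

(** The list [s] holds the columns of a symmetric [D], a combination of the projection and
    [w *m w^T], so that [D *m D] is found by solving a scalar quadratic equation. The root taken
    stays defined at [w = 0]; when [w] has norm [sigma] it equals [sigma^-1], and [D] annihilates
    [w]. *)
Lemma gram_proj_split U w (sigma : R) : 0 < sigma -> w \in U ->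
    l2norm w <= sigma ->
  exists s, gram (w :: s) = sigma ^+ 2 *: orth_proj U /\
    (l2norm w = sigma -> forall b, b \in s -> w^T *m b = 0).
Proof.
move=> s0 wU ws.
set Q := orth_proj U; pose q := l2norm w ^+ 2.
pose r := Num.sqrt (sigma ^+ 2 - q).
have r0 : 0 <= r by exact: sqrtr_ge0.
have qE : q = sigma ^+ 2 - r ^+ 2.
  rewrite sqr_sqrtr ?subKr// subr_ge0 ler_pXn2r ?nnegrE ?l2norm_ge0// ltW//.
have sr0 : sigma + r != 0 by rewrite gt_eqF// ltr_wpDr.
(* k is the root of q k^2 - 2 sigma k + 1 = 0, so that D D^T = sigma^2 Q - w w^T. *)
pose k := (sigma + r)^-1.
pose D := sigma *: Q - k *: (w *m w^T).
have Qw : Q *m w = w by exact: orth_proj_id.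
have wQ : w^T *m Q = w^T.
  by apply: trmx_inj; rewrite trmx_mul trmxK orth_proj_sym Qw.
have DT : D^T = D.
  by rewrite /D linearB/= !linearZ/= trmx_mul trmxK orth_proj_sym.
exists [seq col i D | i <- enum 'I_p]; split.
  rewrite gram_cons (_ : gram _ = D *m D^T); last first.
    apply/matrixP => i j; rewrite gramE big_map big_enum/= !mxE.
    by apply: eq_bigr => l _; rewrite !mxE.
  rewrite DT {1}/D mulmxBl -!scalemxAl /D !mulmxBr -!scalemxAr.
  rewrite orth_proj_idem (mulmxA Q) Qw -(mulmxA w w^T Q) wQ.
  rewrite mulmxA -(mulmxA w w^T w) mxdot_l2norm -/q mul_mx_scalar.
  rewrite -scalemxAl.
  rewrite !scalerBr !scalerA -expr2.
  have coef0 : 1 - sigma * k - (k * sigma - k * (k * q)) = 0.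
    by rewrite qE /k; field.
  move: (w *m w^T) => W; apply/matrixP => i j; rewrite !mxE.
  by rewrite -[RHS]addr0 -(mul0r (W i j)) -coef0; ring.
move=> wE b /mapP[i _ ->].
rewrite colE mulmxA (_ : w^T *m D = 0) ?mul0mx//.
rewrite /D mulmxBr -!scalemxAr wQ mulmxA mxdot_l2norm mul_scalar_mx scalerA -scalerBl.
rewrite wE /k /r /q wE subrr sqrtr0 addr0 expr2 mulKf ?subrr ?scale0r//.
by rewrite gt_eqF.
Qed.

End projection.

(** * Tests between normal laws on the line *)

Section normal_tests.
Context {R : realType}.
Local Notation leb := (@lebesgue_measure R).
Local Notation N01 := (normal_prob (0 : R) 1).
Local Open Scope ereal_scope.

Lemma ge0_integral_normal_shift (m : R) (f : R -> \bar R) :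
  measurable_fun setT f -> (forall x, 0 <= f x) ->
  \int[normal_prob m 1]_x f x = \int[N01]_x f (x + m)%R.
Proof.
move=> mf f0.
have mpdf : measurable_fun setT (fun x => (normal_pdf m 1 x)%:E).
  by apply/measurable_EFinP; exact: measurable_normal_pdf.
pose h x := f x * (normal_pdf m 1 x)%:E.
have mh : measurable_fun setT h by exact: emeasurable_funM.
have h0 x : 0 <= h x by rewrite mule_ge0// lee_fin normal_pdf_ge0.
have mfm : measurable_fun setT (fun x : R => f (x + m)%R).
  by apply: measurableT_comp => //; exact: measurable_funD.
apply: (etrans (ge0_integral_normal_prob m 1 mf f0)).
apply: (etrans (esym (ge0_integral_lebesgue_shift m mh h0))).
apply: (etrans _ (esym (ge0_integral_normal_prob 0 1 mfm (fun x => f0 _)))).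
apply: eq_integral => x _; rewrite /h; congr (_ * _%:E).
by rewrite !normal_pdfE// /normal_fun addrK subr0.
Qed.

(** A null interval would force the density to vanish almost everywhere on it, but the density is
    positive and the interval has positive length. *)
Lemma normal_prob_itv_gt0 (m a b : R) : (a < b)%R ->
  0 < normal_prob m 1 `]a, b].
Proof.
move=> ab; rewrite lt0e measure_ge0 andbT; apply/eqP => N0.
have mab : measurable (`]a, b]%classic : set R) by exact: measurable_itv.
have mpdf : measurable_fun `]a, b] (fun x => (normal_pdf m 1 x)%:E).
  by apply/measurable_funTS/measurable_EFinP; exact: measurable_normal_pdf.
have [|N [mN muN sub]] := (ae_eq_integral_abs leb mab mpdf).1.
  rewrite -[RHS]N0; apply: eq_integral => x _.
  by rewrite gee0_abs// lee_fin normal_pdf_ge0.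
have : leb `]a, b]%classic <= leb N.
  apply: le_measure; rewrite ?inE// => x abx; apply: sub => /= /(_ abx)[]/eqP.
  rewrite normal_pdfE// mulf_eq0 gt_eqF ?normal_peak_gt0//.
  by rewrite /normal_fun gt_eqF// expR_gt0.
by rewrite muN lebesgue_measure_itv/= lte_fin ab -EFinD lee_fin leNgt subr_gt0 ab.
Qed.

Lemma normal_prob_half_line_shift (m t : R) :
  normal_prob m 1 `]t, +oo[ = N01 `](t - m)%R, +oo[.
Proof.
have mi : measurable_fun setT
    (fun x : R => (\1_(`]t, +oo[%classic : set R) x)%:E : \bar R).
  by apply/measurable_EFinP; apply: measurable_indic; exact: measurable_itv.
have i0 x : 0 <= (\1_(`]t, +oo[%classic : set R) x)%:E :> \bar R by rewrite lee_fin.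
have iE (m' s : R) : \int[normal_prob m' 1]_x (\1_(`]s, +oo[%classic : set R) x)%:E =
    normal_prob m' 1 `]s, +oo[%classic.
  by rewrite integral_indic// ?setIT//; exact: measurable_itv.
apply: (etrans (esym (iE _ _))); apply: (etrans _ (iE _ _)).
apply: (etrans (ge0_integral_normal_shift m mi i0)).
apply: eq_integral => x _; rewrite !indicE; congr (_%:R%:E)%R.
by rewrite !mem_setE !in_itv/= !andbT ltrBlDr.
Qed.

Lemma normal_prob_half_line_lt (s t : R) : (s < t)%R ->
  N01 `]t, +oo[ < N01 `]s, +oo[.
Proof.
move=> st.
have -> : `]s, +oo[%classic = `]s, t] `|` `]t, +oo[ :> set R.
  by rewrite -itv_bndbnd_setU// bnd_simp ?ltW.
rewrite measureU//; last first.
  apply/seteqP; split => // x [/=]; rewrite !in_itv/= andbT => /andP[_ xt].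
  by rewrite ltNge xt.
rewrite lteDr ?normal_prob_itv_gt0// ge0_fin_numE//.
by rewrite (le_lt_trans (probability_le1 _ _))// ltry.
Qed.

(* Neyman-Pearson: beyond [mu / 2] the density of N(mu, 1) dominates that of
   N(0, 1), below it is dominated. *)
Lemma neyman_pearson_half_line (mu : R) (psi : R -> R) : (0 < mu)%R ->
  is_test psi -> 'E_(N01)[psi] <= N01 `](mu / 2)%R, +oo[ ->
  'E_(normal_prob mu 1)[psi] <= normal_prob mu 1 `](mu / 2)%R, +oo[.
Proof.
move=> mu0 [mpsi psi01].
pose t := (mu / 2)%R; pose I : R -> R := \1_(`]t, +oo[%classic : set R).
have mI : measurable_fun setT I by apply: measurable_indic; exact: measurable_itv.
have I01 x : (0 <= I x <= 1)%R.
  by rewrite /I indicE; case: (_ \in _); rewrite lexx ler01.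
pose L m (f : R -> R) := \int[leb]_x (f x * normal_pdf m 1 x)%:E.
have LE m (f : R -> R) : measurable_fun setT f -> (forall x, 0 <= f x <= 1)%R ->
    'E_(normal_prob m 1)[f] = L m f.
  move=> mf f01; rewrite unlock ge0_integral_normal_prob//.
    exact/measurable_EFinP.
  by move=> x; rewrite lee_fin; have /andP[] := f01 x.
have probE m : normal_prob m 1 `]t, +oo[ = L m I.
  by rewrite -LE// expectation_indic//; exact: measurable_itv.
rewrite !probE !LE// => psiI.
have mL m (f : R -> R) : measurable_fun setT f ->
    measurable_fun setT (fun x => (f x * normal_pdf m 1 x)%:E).
  move=> mf; apply/measurable_EFinP; apply: measurable_funM => //.
  exact: measurable_normal_pdf.
have L0 m (f : R -> R) x : (forall x, 0 <= f x <= 1)%R ->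
    0 <= (f x * normal_pdf m 1 x)%:E.
  by move=> /(_ x)/andP[f0 _]; rewrite lee_fin mulr_ge0// normal_pdf_ge0.
have LI_fin : L 0%R I \is a fin_num.
  by rewrite -probE ge0_fin_numE// (le_lt_trans (probability_le1 _ _))// ltry.
(* Adding the finite [L 0 I] to both sides and using the level constraint leaves
   [L mu psi + L 0 I <= L mu I + L 0 psi], which is proved pointwise without subtracting
   integrals. *)
rewrite -(leeD2rE _ _ LI_fin) (le_trans _ (leeD2l _ psiI))//.
rewrite /L -!ge0_integralD//; try by [exact: mL|move=> x _; exact: L0].
apply: ge0_le_integral => //; try by apply: emeasurable_funD; exact: mL.
  by move=> x _; rewrite adde_ge0 ?L0.
move=> x _; rewrite -!EFinD lee_fin -subr_ge0.
(* In the factored form both factors change sign at [t]. *)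
have -> : (I x * normal_pdf mu 1 x + psi x * normal_pdf 0 1 x -
    (psi x * normal_pdf mu 1 x + I x * normal_pdf 0 1 x) =
    (I x - psi x) * (normal_pdf mu 1 x - normal_pdf 0 1 x))%R by ring.
have /andP[psi0 psi1] := psi01 x.
have pdf_le a b : ((x - b) ^+ 2 <= (x - a) ^+ 2)%R ->
    (normal_pdf a 1 x <= normal_pdf b 1 x)%R.
  move=> ab; rewrite !normal_pdfE// ler_wpM2l ?normal_peak_ge0// ler_expR.
  by rewrite ler_wpM2r// lerN2.
rewrite /I indicE mem_setE in_itv/= andbT; case: ltP => xt.
  rewrite mulr_ge0// subr_ge0//; apply: pdf_le.
  by rewrite subr0; move: xt; rewrite /t; nra.
rewrite mulr_le0// ?subr_le0//; apply: pdf_le.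
by rewrite subr0; move: xt; rewrite /t; nra.
Qed.

End normal_tests.

(** * Trade-off functions of the mechanism *)

Section mechanism.
Context {R : realType}.
Local Notation N01 := (normal_prob (0 : R) 1).
Local Open Scope ereal_scope.

Lemma gauss_mean_translate p (g : 'cV[R]_p -> \bar R) s (t m : 'cV[R]_p) :
  gauss_mean (fun y => g (t + y)%R) s m = gauss_mean g s (t + m)%R.
Proof.
elim: s m => [//|a s IH] m /=; apply: eq_integral => x _.
by rewrite IH addrA.
Qed.

Lemma gauss_mean_test p (phi : 'cV[R]_p -> R) s (m : 'cV[R]_p) : is_test phi ->
  0 <= gauss_mean (EFin \o phi) s m <= 1.
Proof.
move=> [mphi phi01].
have phi0 y : 0 <= (EFin \o phi) y by rewrite lee_fin; case/andP: (phi01 y).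
have mEphi : measurable_fun setT (EFin \o phi) by exact/measurable_EFinP.
rewrite gauss_mean_ge0//=.
rewrite -[leRHS](gauss_mean_invariant (s := s) (g := cst 1) m)//.
apply: le_gauss_mean => // y; rewrite lee_fin; by case/andP: (phi01 y).
Qed.

(** The noise variable and the factor of its covariance may vary with [S]; only the Gram matrix
    matters, so one list [s] serves all data sets. *)
Lemma expectation_mechanism (X : Type) (n p : nat)
    (theta : n.-tuple X -> 'cV[R]_p) (sigma : R) (d : measure_display)
    (Omega : measurableType d) (Pr : probability Omega R)
    (M : n.-tuple X -> {RV Pr >-> 'cV[R]_p}) S s (phi : 'cV[R]_p -> R) :
  is_rank_deficient_gaussian theta sigma M ->
  gram s = (sigma ^+ 2 *: orth_proj (span_set (sensitivity_space theta)))%R ->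
  is_test phi ->
  'E_(distribution Pr (M S))[phi] = gauss_mean (EFin \o phi) s (theta S).
Proof.
move=> hM gs [mphi phi01]; have [xi xiN ME] := hM S.
have phi0 y : 0 <= (phi y)%:E by rewrite lee_fin; case/andP: (phi01 y).
have mEphi : measurable_fun setT (EFin \o phi) by exact/measurable_EFinP.
have mshift : measurable_fun setT (fun y : 'cV[R]_p => (phi (theta S + y)%R)%:E).
  apply: (measurableT_comp mEphi); apply: measurable_fun_cVP => i.
  under eq_fun do rewrite mxE.
  by apply: measurable_funD => //; exact: measurable_coord.
rewrite -[theta S in RHS]addr0 -gauss_mean_translate.
rewrite unlock.
apply: (etrans (ge0_integral_distribution (M S) mEphi phi0)).
apply: (etrans _ (integral_is_normal xiN gs mshift (fun y => phi0 _))).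
apply: (etrans _ (esym (ge0_integral_distribution xi mshift (fun y => phi0 _)))).
by apply: eq_integral => w _ /=; rewrite ME.
Qed.

Lemma gauss_tradeoff_le (mu a : R) (psi : R -> R) : is_test psi ->
  'E_(N01)[psi] <= a%:E ->
  gauss_tradeoff mu a <= 1 - 'E_(normal_prob mu 1)[psi].
Proof. by move=> tpsi psia; apply: ereal_inf_lbound; exists psi. Qed.

(* Randomising over the columns [s] turns a test on [p]-space into a test on
   the line with the same error probabilities. *)
Lemma gauss_tradeoff_le_gauss_mean p (mu a : R) (phi : 'cV[R]_p -> R) s
    (w m : 'cV[R]_p) :
  is_test phi -> gauss_mean (EFin \o phi) (w :: s) m <= a%:E ->
  gauss_tradeoff mu a <= 1 - gauss_mean (EFin \o phi) (w :: s) (m + mu *: w)%R.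
Proof.
move=> tphi phia; have [mphi phi01] := tphi.
pose psi (t : R) := fine (gauss_mean (EFin \o phi) s (m + t *: w)%R).
have J01 y := gauss_mean_test s y tphi.
have psiE t : (psi t)%:E = gauss_mean (EFin \o phi) s (m + t *: w)%R.
  have /andP[J0 J1] := J01 (m + t *: w)%R.
  by rewrite fineK// ge0_fin_numE// (le_lt_trans J1)// ltry.
have phi0 y : 0 <= (EFin \o phi) y by rewrite lee_fin; case/andP: (phi01 y).
have mEphi : measurable_fun setT (EFin \o phi) by exact/measurable_EFinP.
have mpsi : measurable_fun setT psi.
  apply/measurable_EFinP; rewrite (_ : EFin \o psi =
    (fun t => gauss_mean (EFin \o phi) s (m + t *: w)%R)); last exact/funext.
  apply: measurableT_comp; first exact: measurable_gauss_mean.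
  exact: measurable_shift_line.
have psi01 t : (0 <= psi t <= 1)%R by rewrite -!lee_fin psiE.
have psi0 t : 0 <= (psi t)%:E by rewrite psiE; case/andP: (J01 (m + t *: w)%R).
have tpsi : is_test psi by [].
have E0 : 'E_(N01)[psi] = gauss_mean (EFin \o phi) (w :: s) m.
  by rewrite unlock; apply: eq_integral => t _; rewrite psiE.
have E1 : 'E_(normal_prob mu 1)[psi] =
    gauss_mean (EFin \o phi) (w :: s) (m + mu *: w)%R.
  rewrite unlock.
  have mEpsi : measurable_fun setT (EFin \o psi) by exact/measurable_EFinP.
  apply: (etrans (ge0_integral_normal_shift mu mEpsi psi0)).
  apply: eq_integral => t _ /=.
  by rewrite psiE scalerDl (addrC (t *: w)%R) addrA.
by rewrite -E1; apply: gauss_tradeoff_le => //; rewrite E0.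
Qed.

End mechanism.

(** * Half-space tests *)

Section half_space.
Context {R : realType} {p : nat}.
Implicit Types (w m : 'cV[R]_p) (c t : R).
Local Notation N01 := (normal_prob (0 : R) 1).
Local Open Scope ereal_scope.

Definition half_space w c : set 'cV[R]_p :=
  [set y | (c < \sum_i w i 0 * y i 0)%R].

Lemma measurable_half_space w c : measurable (half_space w c).
Proof.
have ml : measurable_fun setT (fun y : 'cV[R]_p => \sum_i w i 0 * y i 0)%R.
  apply: measurable_sum => i; apply: measurable_funM => //.
  exact: measurable_coord.
rewrite (_ : half_space w c =
  (fun y : 'cV[R]_p => \sum_i w i 0 * y i 0)%R @^-1` `]c, +oo[); last first.
  by apply/seteqP; split=> y; rewrite /half_space /= in_itv/= andbT.
by rewrite -[_ @^-1` _]setTI; apply: ml => //; exact: measurable_itv.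
Qed.

(** Columns orthogonal to [w] leave the linear form unchanged, while a step [x] along [w] adds
    [x * l2norm w ^+ 2] to it. *)
Lemma gauss_mean_half_space w s m (c : R) :
  (0 < l2norm w)%R -> (forall b, b \in s -> w^T *m b = 0)%R ->
  gauss_mean (fun y => (\1_(half_space w c) y)%:E) (w :: s) m =
  N01 `]((c - \sum_i w i 0 * m i 0) / l2norm w ^+ 2)%R, +oo[%classic.
Proof.
move=> w0 ws /=.
have dotD y (x : R) (a : 'cV[R]_p) : (\sum_i w i 0 * (y + x *: a) i 0 =
    \sum_i w i 0 * (y : 'cV[R]_p) i 0 + x * (w^T *m a) 0 0)%R.
  rewrite mxdotE mulr_sumr -big_split/=; apply: eq_bigr => i _.
  by rewrite !mxE; ring.
have inE' y : (y \in half_space w c) = (c < \sum_i w i 0 * y i 0)%R.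
  by apply/idP/idP; rewrite inE.
under eq_integral => x _.
  rewrite gauss_mean_invariant; last 2 first.
  - move=> b /ws wb y x'; congr (_%:E); rewrite !indicE; congr (_%:R)%R.
    by rewrite !inE' dotD wb mxE mulr0 addr0.
  - by move=> y; rewrite lee_fin.
  over.
set h := (_ / _)%R.
rewrite -(setIT `]h, +oo[%classic) -(integral_indic N01 measurableT); last first.
  exact: measurable_itv.
apply: eq_integral => x _; congr (_%:E); rewrite !indicE; congr (_%:R)%R.
rewrite inE' dotD mxdot_l2norm mxE eqxx mulr1n mem_setE in_itv/= andbT.
by rewrite /h ltr_pdivrMr ?exprn_gt0// ltrBlDl.
Qed.

End half_space.

(** * Pairwise sensitivity bounds and the two directions of the equivalence *)

Lemma l2norm_subC (R : realType) p (v w : 'cV[R]_p) :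
  l2norm (v - w) = l2norm (w - v).
Proof.
by rewrite /l2norm; congr Num.sqrt; apply: eq_bigr => i _; rewrite !mxE -sqrrN opprB.
Qed.

(** Without neighbors the supremum is [-oo] and both sides hold. *)
Lemma l2_sensitivity_leP (R : realType) (X : Type) (n p : nat) (mu sigma : R)
    (theta : n.-tuple X -> 'cV[R]_p) : 0 < mu ->
  (l2_sensitivity theta / mu%:E <= sigma%:E)%E <->
  forall S S', neighbors S S' -> l2norm (theta S' - theta S) <= mu * sigma.
Proof.
move=> mu0; rewrite inver gt_eqF// lee_pdivrMr// -EFinM mulrC; split=> [h S S' SS'|h].
  rewrite -lee_fin; apply: le_trans h; apply: ereal_sup_ubound.
  by exists (S, S') => //=; rewrite l2norm_subC.
by apply: ge_ereal_sup => _ [[S S'] /= SS' <-]; rewrite lee_fin l2norm_subC h.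
Qed.

Section gdp.
Context (R : realType) (X : Type) (n p : nat).
Context (mu : R) (hmu : 0 < mu) (theta : n.-tuple X -> 'cV[R]_p).
Context (sigma : R) (hsigma : 0 < sigma).
Context (d : measure_display) (Omega : measurableType d) (Pr : probability Omega R).
Context (M : n.-tuple X -> {RV Pr >-> 'cV[R]_p}).
Context (hM : is_rank_deficient_gaussian theta sigma M).
Local Notation N01 := (normal_prob (0 : R) 1).

Lemma sensitivity_span S S' : neighbors S S' ->
  theta S' - theta S \in span_set (sensitivity_space theta).
Proof.
move=> SS'; rewrite -opprB rpredN.
by apply: (span_set_least (sensitivity_space theta)).1; exists (S, S').
Qed.

Lemma gaussian_mechanism_tradeoff_ge S S' (a : R) : neighbors S S' ->
  l2norm (theta S' - theta S) <= mu * sigma ->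
  (gauss_tradeoff mu a <=
   tradeoff (distribution Pr (M S)) (distribution Pr (M S')) a)%E.
Proof.
move=> SS' le_sens; pose w := mu^-1 *: (theta S' - theta S).
have wU : w \in span_set (sensitivity_space theta).
  by rewrite memvZ// sensitivity_span.
have ws : l2norm w <= sigma.
  by rewrite l2normZ ?invr_ge0 ?(ltW hmu)// mulrC ler_pdivrMr// mulrC.
have [s [gs _]] := gram_proj_split hsigma wU ws.
apply: le_ereal_inf_tmp => _ [phi [tphi phia] <-].
rewrite (expectation_mechanism S' hM gs tphi).
have -> : theta S' = theta S + mu *: w.
  by rewrite /w scalerA divff ?gt_eqF// scale1r addrC subrK.
apply: gauss_tradeoff_le_gauss_mean => //.
by rewrite -(expectation_mechanism S hM gs tphi).
Qed.

Lemma gaussian_mechanism_sensitivity_le S S' : neighbors S S' ->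
  (forall a : R, 0 <= a <= 1 -> (gauss_tradeoff mu a <=
    tradeoff (distribution Pr (M S)) (distribution Pr (M S')) a)%E) ->
  l2norm (theta S' - theta S) <= mu * sigma.
Proof.
move=> SS' gdp; rewrite leNgt; apply/negP => gt_sens.
pose v := theta S' - theta S; pose m := l2norm v / sigma.
have mum : mu < m by rewrite ltr_pdivlMr.
have m0 : 0 < m by exact: lt_trans mum.
pose w := m^-1 *: v.
have wU : w \in span_set (sensitivity_space theta).
  by rewrite memvZ// sensitivity_span.
have v0 : 0 < l2norm v by rewrite (lt_trans _ gt_sens)// mulr_gt0.
(* The norm is exactly [sigma], which makes the remaining columns orthogonal to [w]. *)
have ws : l2norm w = sigma.
  by rewrite l2normZ ?invr_ge0 ?(ltW m0)// /m invf_div mulrVK ?unitfE ?gt_eqF.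
have ws' : l2norm w <= sigma by rewrite ws.
have [s [gs /(_ ws) orth]] := gram_proj_split hsigma wU ws'.
have w0 : 0 < l2norm w by rewrite ws.
have sN0 : sigma != 0 by rewrite gt_eqF.
(* Under [S] the linear form is its value at [theta S] plus [sigma ^+ 2] times a standard normal
   [t], so this threshold reads [mu / 2 < t]. *)
pose c := \sum_i w i 0 * theta S i 0 + sigma ^+ 2 * (mu / 2).
pose phi : 'cV[R]_p -> R := \1_(half_space w c).
have tphi : is_test phi.
  split=> [|y]; first by apply: measurable_indic; exact: measurable_half_space.
  by rewrite /phi indicE; case: (_ \in _); rewrite lexx ler01.
have EP : ('E_(distribution Pr (M S))[phi] = N01 `](mu / 2)%R, +oo[%classic)%E.
  rewrite (expectation_mechanism S hM gs tphi).
  apply: (etrans (gauss_mean_half_space (theta S) c w0 orth)).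
  rewrite (_ : (c - _) / _ = mu / 2)//.
  by rewrite /c ws; field.
have EQ : ('E_(distribution Pr (M S'))[phi] = N01 `](mu / 2 - m)%R, +oo[%classic)%E.
  rewrite (expectation_mechanism S' hM gs tphi).
  apply: (etrans (gauss_mean_half_space (theta S') c w0 orth)).
  rewrite (_ : (c - _) / _ = mu / 2 - m)//.
  have -> : \sum_i w i 0 * theta S' i 0 =
      \sum_i w i 0 * theta S i 0 + m * sigma ^+ 2.
    have -> : theta S' = theta S + m *: w.
      by rewrite /w scalerA divff ?gt_eqF// scale1r addrC subrK.
    rewrite -ws; have /(congr1 (fun A : 'M[R]_1 => A 0 0)) := mxdot_l2norm w.
    rewrite mxdotE mxE eqxx mulr1n => <-.
    rewrite mulr_sumr -big_split; apply: eq_bigr => i _ /=.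
    by rewrite !mxE; ring.
  by rewrite /c ws; field.
have Nfin t : exists r : R, N01 `]t, +oo[%classic = r%:E.
  exists (fine (N01 `]t, +oo[%classic)); rewrite fineK// ge0_fin_numE//.
  by rewrite (le_lt_trans (probability_le1 _ _))// ltry.
have [a aE] := Nfin (mu / 2).
have a01 : 0 <= a <= 1.
  by rewrite -!lee_fin -aE measure_ge0 probability_le1.
have lowG :
    (1 - normal_prob mu 1 `](mu / 2)%R, +oo[%classic <= gauss_tradeoff mu a)%E.
  apply: le_ereal_inf_tmp => _ [psi [tpsi psia] <-].
  by apply: leeB => //; apply: neyman_pearson_half_line => //; rewrite aE.
have upG : (gauss_tradeoff mu a <= 1 - N01 `](mu / 2 - m)%R, +oo[%classic)%E.
  apply: le_trans (gdp a a01) _; rewrite -EQ; apply: ereal_inf_lbound.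
  by exists phi => //; split => //; rewrite EP aE.
(* The two bounds make the normal tail beyond [mu / 2 - m] at most the one beyond [mu / 2 - mu],
   against strict monotonicity since [mu < m]. *)
have := le_trans lowG upG; rewrite normal_prob_half_line_shift.
have : mu / 2 - m < mu / 2 - mu by rewrite ltrD2l ltrN2.
move=> /normal_prob_half_line_lt.
have [x ->] := Nfin (mu / 2 - mu); have [y ->] := Nfin (mu / 2 - m).
by rewrite -!EFinB lte_fin lee_fin lerD2l lerN2 => /lt_geF ->.
Qed.

End gdp.

Unset Implicit Arguments.

Theorem theorem3 (R : realType) (X : Type) (n p : nat) (hn : (1 <= n)%N)
    (mu : R) (hmu : 0 < mu)
    (theta : n.-tuple X -> 'cV[R]_p) (htheta : rank_deficient theta)
    (sigma : R) (hsigma : 0 < sigma)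
    (d : measure_display) (Omega : measurableType d) (Pr : probability Omega R)
    (M : n.-tuple X -> {RV Pr >-> 'cV[R]_p})
    (hM : is_rank_deficient_gaussian theta sigma M) :
  is_gdp mu M <-> (l2_sensitivity theta / mu%:E <= sigma%:E)%E.
Proof.
rewrite l2_sensitivity_leP//; split=> [gdp S S' SS'|le_sens a _].
  apply: (gaussian_mechanism_sensitivity_le hmu hsigma hM SS') => a a01.
  by apply: le_trans (gdp a a01) _; apply: ereal_inf_lbound; exists (S, S').
apply: le_ereal_inf_tmp => _ [[S S'] /= SS' <-].
exact: (gaussian_mechanism_tradeoff_ge hmu hsigma hM a SS' (le_sens _ _ SS')).
Qed.
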